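(* Let $K \geq 1$, $B \in \mathbb{R}^K$, $v \in (-\pi,\pi]^K$ with $v_1 < v_2 < \cdots < v_K$, and $\alpha > 0$. The algorithm $\mathrm{distTransCirc}(B, v, \alpha)$ defined in the context returns the vector $D \in \mathbb{R}^K$ given by $$D_k = \min_{1 \leq l \leq K} \big( B_l + \alpha\, d_{\mathbb{T}}(v_k, v_l) \big), \qquad k = 1,\ldots,K,$$ and it does so in $O(K)$ operations.
   Context: Points of the unit circle $\mathbb{T} = \mathbb{S}^1$ are represented by their angles in $(-\pi,\pi]$, and $d_{\mathbb{T}}$ denotes the arc length distance on the circle; in terms of angles $u, w \in (-\pi,\pi]$, it is the length of the shorter arc between the two corresponding points. The algorithm $\mathrm{distTransReal}(B',v',\alpha)$, for $B' \in \mathbb{R}^M$, $v' \in \mathbb{R}^M$ sorted in ascending order and $\alpha > 0$, is the following: 1. Set $D' \leftarrow B'$. 2. For $k = 2, 3, \ldots, M$, in this order, set $D'_k \leftarrow \min\big(D'_{k-1} + \alpha(v'_k - v'_{k-1}),\; D'_k\big)$. 3. For $k = M-1, M-2, \ldots, 1$, in this order, set $D'_k \leftarrow \min\big(D'_{k+1} + \alpha(v'_{k+1} - v'_k),\; D'_k\big)$. 4. Return $D'$ (entries are overwritten in place). The algorithm $\mathrm{distTransCirc}(B,v,\alpha)$, for $B \in \mathbb{R}^K$, $v \in (-\pi,\pi]^K$ sorted in ascending order and $\alpha > 0$, is the following: 1. Set $B' \leftarrow (B_1,\ldots,B_K,\, B_1,\ldots,B_K,\, B_1,\ldots,B_K)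 \in \mathbb{R}^{3K}$. 2. Set $v' \leftarrow (v_1 - 2\pi,\ldots,v_K - 2\pi,\; v_1,\ldots,v_K,\; v_1+2\pi,\ldots,v_K+2\pi) \in \mathbb{R}^{3K}$. 3. Set $D' \leftarrow \mathrm{distTransReal}(B',v',\alpha)$. 4. Return $D = (D'_{K+1},\ldots,D'_{2K})$. Complexity is measured by the number of elementary operations (arithmetic operations, comparisons and assignments on real numbers, each at unit cost). *)

(* Defs.v *)
From mathcomp Require Import all_boot all_order all_algebra.
From mathcomp Require Import reals trigo.

Set Implicit Arguments.
Unset Strict Implicit.
Unset Printing Implicit Defensive.

Import Order.TTheory GRing.Theory Num.Theory.

Local Open Scope ring_scope.

(* A computation is a value together with the number of elementary operations
   performed to obtain it. In the algorithms below every arithmetic operation,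
   comparison and assignment on real numbers is charged one unit, by addc, subc,
   mulc, lec, writec, or by mapc (one assignment per entry). Reading an array cell,
   handling indices and juxtaposing arrays are not operations on real numbers
   and are free. *)
Record costed (A : Type) := Costed { outcome : A; cost : nat }.

Definition retc (A : Type) (a : A) : costed A := Costed a 0.

Definition bindc (A A' : Type) (m : costed A) (f : A -> costed A') :
    costed A' :=
  Costed (outcome (f (outcome m))) (cost m + cost (f (outcome m)))%N.

Notation "'let*' x ':=' m 'in' k" := (bindc m (fun x => k))
  (at level 200, x name, m at level 200, k at level 200).

Fixpoint forc (A : Type) (ks : seq nat) (body : nat -> A -> costed A) (s : A) :
    costed A :=
  if ks is k :: ks' then let* s' := body k s in forc ks' body s' else retc s.

Section Algorithms.
Variable R : realType.
Implicit Types (x y alpha : R) (B v D : seq R).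

Definition addc x y : costed R := Costed (x + y) 1.
Definition subc x y : costed R := Costed (x - y) 1.
Definition mulc x y : costed R := Costed (x * y) 1.
Definition lec x y : costed bool := Costed (x <= y) 1.

Definition minc x y : costed R :=
  let* b := lec x y in retc (if b then x else y).

(* Arrays are sequences, indexed from 0; D`_k is the cell of index k. *)
Definition writec D (k : nat) x : costed (seq R) := Costed (set_nth 0 D k x) 1.

(* The array of the values of f on the entries of s: on top of the cost of f,
   each entry costs one assignment. In particular, mapc retc copies s. *)
Fixpoint mapc (f : R -> costed R) (s : seq R) : costed (seq R) :=
  if s is x :: s' then
    let* y := f x in
    let* t := mapc f s' in
    Costed (y :: t) 1
  else retc [::].

(* D_k <- min (D_j + alpha * (v_p - v_q), D_k) *)
Definition relaxc v alpha (j p q k : nat) D : costed (seq R) :=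
  let* d := subc v`_p v`_q in
  let* e := mulc alpha d in
  let* s := addc D`_j e in
  let* m := minc s D`_k in
  writec D k m.

(* The loop ranges are k = 1, ..., M - 1 and k = M - 2, ..., 0, that is
   2, ..., M and M - 1, ..., 1 when indexing from 1. *)
Definition distTransReal B v alpha : costed (seq R) :=
  let M := size B in
  let* D0 := mapc (@retc R) B in
  let* D1 := forc (iota 1 M.-1)
               (fun k D => relaxc v alpha k.-1 k k.-1 k D) D0 in
  forc (rev (iota 0 M.-1))
    (fun k D => relaxc v alpha k.+1 k.+1 k k D) D1.

Definition distTransCirc B v alpha : costed (seq R) :=
  let K := size B in
  let* B' := mapc (@retc R) (B ++ B ++ B) in
  let* c := mulc 2 pi in
  let* vl := mapc (fun x => subc x c) v in
  let* vm := mapc (@retc R) v in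
  let* vr := mapc (fun x => addc x c) v in
  let* D' := distTransReal B' (vl ++ vm ++ vr) alpha in
  mapc (@retc R) (take K (drop K D')).

(* For angles in ]-pi, pi], the two arcs joining the points of angles u and w
   have lengths `|u - w| and 2 * pi - `|u - w|. *)
Definition arc_dist (u w : R) : R :=
  Num.min `|u - w| (2 * pi - `|u - w|).

End Algorithms.

(* Main.v *)
Require Import Defs.
From mathcomp Require Import all_boot all_order all_algebra.
From mathcomp Require Import reals trigo.
From mathcomp Require Import zify lra.

(** The vector to compute is a lower envelope of cones: site [l] contributes the
cone of apex value [B_l] and slope [alpha] centred at [v_l]. The proof treats the
algorithm on the line, then unrolls the circle onto it.

On the line, being the minimum of the cones at [k] splits into two properties of
the computed array [D]. First, [D_k] lies above some cone at [k]; this holds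
initially and survives every relaxation, in whatever order they are made, by the
triangle inequality ([supported_relaxc]). Asking only for a cone below [D_k], and
not for equality with one, is what makes it invariant: a relaxation that walks
back towards its site computes a value that need not be on any cone. Second,
[D_k] lies below every cone at [k]. As the sites are sorted, the relaxations of
the forward sweep telescope along [l <= k] ([forward_sweep]) and those of the
backward sweep along [k <= l] ([backward_sweep]). The two properties
([distTransRealP]) force [D_k] to be the minimum.

On the circle, the arc between two angles of ]-pi, pi] is the shortest distance
from the first to the three copies of the second translated by -2 pi, 0 and 2 pi
([arc_distE]), and these copies form a sorted array ([sorted_unroll]). So the
middle block of the output on the line is the minimum over the circle.

For the cost, each relaxation takes 5 operations, the two sweeps over [3 K] sites
make [2 (3 K - 1)] of them, and copies and translations are linear; the total is
exactly [42 K - 9] ([cost_distTransCirc]). *)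

Import Order.TTheory GRing.Theory Num.Theory.

Local Open Scope ring_scope.

(** * Loops *)

(** In the two invariant rules, [I k] describes the state when [k] is the frontier
between visited and unvisited indices: the visited ones lie below [k] in an
ascending loop, at or above [k] in a descending one. *)
Lemma forc_up {A : Type} (I : nat -> A -> Prop) body m n s :
  I m s ->
  (forall k t, (m <= k < m + n)%N -> I k t -> I k.+1 (outcome (body k t))) ->
  I (m + n)%N (outcome (forc (iota m n) body s)).
Proof.
elim: n m s => [|n IHn] m s Is step /=; first by rewrite addn0.
rewrite -addSnnS; apply: IHn => [|k t lek]; apply: step => //; lia.
Qed.

Lemma forc_down {A : Type} (I : nat -> A -> Prop) body n s :
  I n s ->
  (forall k t, (k < n)%N -> I k.+1 t -> I k (outcome (body k t))) ->
  I 0%N (outcome (forc (rev (iota 0 n)) body s)).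
Proof.
elim: n s => [|n IHn] s Is step //.
rewrite -addn1 iotaD rev_cat /=; apply: IHn => [|k t ltk]; apply: step => //; lia.
Qed.

Lemma cost_forc {A : Type} c (body : nat -> A -> costed A) ks s :
  (forall k t, cost (body k t) = c) ->
  cost (forc ks body s) = (c * size ks)%N.
Proof.
by move=> cb; elim: ks s => [|k ks IHks] s /=; rewrite ?muln0 // IHks cb mulnS.
Qed.

Lemma outcome_mapc {R : realType} (f : R -> costed R) s :
  outcome (mapc f s) = [seq outcome (f x) | x <- s].
Proof. by elim: s => //= x s ->. Qed.

Lemma outcome_copy {R : realType} (s : seq R) : outcome (mapc (@retc R) s) = s.
Proof. by rewrite outcome_mapc map_id. Qed.

Lemma cost_mapc {R : realType} c (f : R -> costed R) s :
  (forall x, cost (f x) = c) -> cost (mapc f s) = (c.+1 * size s)%N.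
Proof. by move=> cf; elim: s => [|x s IHs] /=; rewrite ?muln0 // IHs cf; lia. Qed.

(** * The two sweeps on the real line *)

Definition cone {R : realType} (B v : seq R) (alpha : R) (l k : nat) : R :=
  B`_l + alpha * `|v`_k - v`_l|.

(** The lower bound half of being the envelope of the cones, weakened from
equality with a cone to an inequality so that relaxations preserve it. *)
Definition supported {R : realType} (B v : seq R) (alpha : R) (D : seq R) :=
  forall k, (k < size B)%N ->
    exists2 l, (l < size B)%N & cone B v alpha l k <= D`_k.

Lemma size_relaxc {R : realType} (v D : seq R) alpha j p q k :
  (k < size D)%N -> size (outcome (relaxc v alpha j p q k D)) = size D.
Proof. by move=> ltk; rewrite size_set_nth; apply/maxn_idPr. Qed.

Lemma nth_relaxc {R : realType} (v D : seq R) alpha j p q k i :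
  (outcome (relaxc v alpha j p q k D))`_i =
    if i == k then Num.min (D`_j + alpha * (v`_p - v`_q)) D`_k else D`_i.
Proof. by rewrite nth_set_nth /= minEle. Qed.

(** If the cone of [l] is below [D] at [j], it is also below the relaxed value at
[k], since it grows by at most [alpha * `|v_k - v_j|] from [j] to [k]. *)
Lemma supported_relaxc {R : realType} (B v D : seq R) alpha j p q k :
  0 <= alpha -> (j < size B)%N -> v`_p - v`_q = `|v`_k - v`_j| ->
  supported B v alpha D ->
  supported B v alpha (outcome (relaxc v alpha j p q k D)).
Proof.
move=> a0 ltj dpq supD i lti; rewrite nth_relaxc.
case: eqP => [-> {i}|_] in lti *; last exact: supD.
rewrite dpq minElt; case: ifP => _; last exact: supD.
have [l ltl Djl] := supD j ltj; exists l => //.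
apply: le_trans (lerD Djl (lexx _)).
by rewrite /cone -addrA lerD2l -mulrDr ler_wpM2l // [leRHS]addrC ler_distD.
Qed.

Lemma supported_refl {R : realType} (B v : seq R) alpha : supported B v alpha B.
Proof. by move=> k ltk; exists k; rewrite // /cone subrr normr0 mulr0 addr0. Qed.

Lemma sorted_nth_le {R : realType} (v : seq R) i j :
  sorted <=%R v -> (i <= j < size v)%N -> v`_i <= v`_j.
Proof.
move=> sv /andP[leij ltj].
apply: (sorted_leq_nth le_trans le_refl) => //.
exact: leq_ltn_trans ltj.
Qed.

(** The bound for [l < k] telescopes: it holds at [k.-1] when [k] is visited, and
the relaxation adds exactly [alpha * (v_k - v_(k-1))]. *)
Lemma forward_sweep {R : realType} (B v : seq R) (alpha : R) :
  0 <= alpha -> sorted <=%R v -> size v = size B ->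
  let D := outcome (forc (iota 1 (size B).-1)
             (fun k D => relaxc v alpha k.-1 k k.-1 k D) B) in
  supported B v alpha D /\
  forall l k, (l <= k < size B)%N -> D`_k <= B`_l + alpha * (v`_k - v`_l).
Proof.
move=> a0 sv sz.
pose I n (D : seq R) := [/\ supported B v alpha D,
  forall k, D`_k <= B`_k &
  forall l k, (l <= k < n)%N -> D`_k <= B`_l + alpha * (v`_k - v`_l)].
have [] : I (1 + (size B).-1)%N (outcome (forc (iota 1 (size B).-1)
             (fun k D => relaxc v alpha k.-1 k k.-1 k D) B)).
  apply: forc_up.
    (* At frontier 1, only the cell 0 counts as visited. *)
    split=> //; first exact: supported_refl.
    by move=> l k /andP[lk k1]; rewrite (_ : k = l) ?subrr ?mulr0 ?addr0 //; lia.
  move=> k D ltk [supD leD ubD].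
  have le_v i : (i <= k)%N -> v`_i <= v`_k by move=> ?; apply: sorted_nth_le => //; lia.
  split.
  - apply: supported_relaxc => //; first lia.
    by rewrite ger0_norm // subr_ge0; apply: le_v; lia.
  - by move=> i; rewrite nth_relaxc; case: eqP => // ->; rewrite ge_min leD orbT.
  - move=> l i lei; rewrite nth_relaxc; case: eqP => [eik|neik]; last by apply: ubD; lia.
    rewrite ge_min eik; apply/orP.
    have [ltlk|gelk] := ltnP l k; last first.
      by right; rewrite (_ : l = k) ?subrr ?mulr0 ?addr0 //; lia.
    left; have := ubD l k.-1 ltac:(lia); lra.
by move=> supD leD ubD; split=> // l k ltk; apply: ubD; lia.
Qed.

(** The input [E] of this sweep is kept apart from the array [B] of apex values:
the upper bounds are relative to [E], to be combined with those of the forward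
sweep, whereas the supporting cones are still those of [B]. *)
Lemma backward_sweep {R : realType} (B v E : seq R) (alpha : R) :
  0 <= alpha -> sorted <=%R v -> size v = size B -> supported B v alpha E ->
  let D := outcome (forc (rev (iota 0 (size B).-1))
             (fun k D => relaxc v alpha k.+1 k.+1 k k D) E) in
  supported B v alpha D /\
  forall k l, (k <= l < size B)%N -> D`_k <= E`_l + alpha * (v`_l - v`_k).
Proof.
move=> a0 sv sz supE.
pose I n (D : seq R) := [/\ supported B v alpha D,
  forall k, D`_k <= E`_k &
  forall k l, (n <= k)%N -> (k <= l < size B)%N ->
    D`_k <= E`_l + alpha * (v`_l - v`_k)].
have [] : I 0%N (outcome (forc (rev (iota 0 (size B).-1))
             (fun k D => relaxc v alpha k.+1 k.+1 k k D) E)).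
  apply: forc_down.
    (* The last cell is visited from the start, as it has no right neighbour. *)
    split=> // k l lek ltl.
    by rewrite (_ : k = l) ?subrr ?mulr0 ?addr0 //; lia.
  move=> k D ltk [supD leD ubD].
  split.
  - apply: supported_relaxc => //; first lia.
    rewrite distrC ger0_norm // subr_ge0; apply: sorted_nth_le => //; lia.
  - by move=> i; rewrite nth_relaxc; case: eqP => // ->; rewrite ge_min leD orbT.
  - move=> i l lei ltl; rewrite nth_relaxc; case: eqP => [eik|neik]; last by apply: ubD; lia.
    rewrite ge_min eik; apply/orP.
    have [ltlk|gelk] := ltnP k l; last first.
      by right; rewrite (_ : l = k) ?subrr ?mulr0 ?addr0 //; lia.
    left; have := ubD k.+1 l ltac:(lia) ltac:(lia); lra.
by move=> supD leD ubD; split=> // k l ltl; apply: ubD.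
Qed.

Lemma size_distTransReal {R : realType} (B v : seq R) (alpha : R) :
  size (outcome (distTransReal B v alpha)) = size B.
Proof.
pose I (_ : nat) (D : seq R) := size D = size B.
rewrite /= outcome_copy; apply: (forc_down I); first apply: (forc_up I) => //.
  all: by move=> k D ltk sD; rewrite /I size_relaxc sD //; lia.
Qed.

(** The cones on the left of [k] are handled by the forward sweep, as the backward
sweep can only decrease [D_k]; those on the right by the backward sweep, as the
forward values it starts from are at most those of [B]. *)
Lemma distTransRealP {R : realType} (B v : seq R) (alpha : R) :
  0 <= alpha -> sorted <=%R v -> size v = size B ->
  let D := outcome (distTransReal B v alpha) in
  supported B v alpha D /\
  forall k l, (k < size B)%N -> (l < size B)%N -> D`_k <= cone B v alpha l k.
Proof.
move=> a0 sv sz; rewrite /= outcome_copy.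
have [supE ubE] := forward_sweep B v alpha a0 sv sz.
have [supD ubD] := backward_sweep B v _ alpha a0 sv sz supE.
split=> // k l ltk ltl; rewrite /cone.
have [lelk|ltkl] := leqP l k.
  have lev : v`_l <= v`_k by apply: sorted_nth_le => //; lia.
  rewrite ger0_norm ?subr_ge0 //.
  have := ubE l k ltac:(lia); have := ubD k k ltac:(lia).
  by rewrite subrr mulr0 addr0; apply: le_trans.
have lev : v`_k <= v`_l by apply: sorted_nth_le => //; lia.
rewrite distrC ger0_norm ?subr_ge0 //.
have := ubE l l ltac:(lia); have := ubD k l ltac:(lia).
rewrite subrr mulr0 addr0; lra.
Qed.

(** * Unrolling the circle *)

Definition unroll {R : realType} (v : seq R) : seq R :=
  [seq x - 2 * pi | x <- v] ++ v ++ [seq x + 2 * pi | x <- v].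

Lemma outcome_distTransCirc {R : realType} (B v : seq R) (alpha : R) :
  outcome (distTransCirc B v alpha) =
    take (size B) (drop (size B)
      (outcome (distTransReal (B ++ B ++ B) (unroll v) alpha))).
Proof. by rewrite /distTransCirc /= !outcome_copy !outcome_mapc. Qed.

(** Consecutive blocks do not interleave because the angles lie in an interval of
length [2 * pi]. *)
Lemma sorted_unroll {R : realType} (v : seq R) :
  sorted <=%R v -> {in v, forall x, - pi < x <= pi} -> sorted <=%R (unroll v).
Proof.
rewrite !le_sorted_pairwise !pairwise_cat !pairwise_map => sv v_pi.
have pi0 := pi_gt0 R.
rewrite allrel_catr allrel_mapl allrel_mapr allrel_mapl allrel_mapr sv.
apply/and4P; split=> //.
- by apply/andP; split; apply/allrelP => x y /v_pi xpi /v_pi ypi; lra.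
- by apply: sub_pairwise sv => x y /=; rewrite lerD2r.
- by apply/allrelP => x y /v_pi xpi /v_pi ypi; lra.
- by apply: sub_pairwise sv => x y /=; rewrite lerD2r.
Qed.

Lemma size_unroll {R : realType} (v : seq R) : size (unroll v) = (3 * size v)%N.
Proof. by rewrite !size_cat !size_map mulSn mul2n -addnn. Qed.

(** As [`|u - w| < 2 * pi], the translate of [w] on the far side of [u] from [w]
is at distance [2 * pi - `|u - w|], the length of the complementary arc, and the
other translate is at distance [2 * pi + `|u - w|], which does not affect the
minimum. *)
Lemma arc_distE {R : realType} (u w : R) :
  - pi < u <= pi -> - pi < w <= pi ->
  arc_dist u w =
    Num.min `|u - w| (Num.min `|u - (w - 2 * pi)| `|u - (w + 2 * pi)|).
Proof.
move=> upi wpi; have pi0 := pi_gt0 R; rewrite /arc_dist; congr Num.min.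
rewrite (@ger0_norm _ (u - (w - 2 * pi))) ?(@ler0_norm _ (u - (w + 2 * pi))); try lra.
case: (ler0P (u - w)) => s; [rewrite min_l | rewrite min_r]; lra.
Qed.

Lemma size_distTransCirc {R : realType} (B v : seq R) (alpha : R) :
  size (outcome (distTransCirc B v alpha)) = size B.
Proof.
rewrite outcome_distTransCirc size_take size_drop size_distTransReal !size_cat.
by case: ifP; lia.
Qed.

(** The entries of the middle block have indices [K + k]; the three equations
describe the cones of the three copies of site [l] there. *)
Lemma cone_unroll {R : realType} (B v : seq R) (alpha : R) k l :
  size v = size B -> (k < size B)%N -> (l < size B)%N ->
  let K := size B in let u := v`_k in let w := v`_l in
  [/\ cone (B ++ B ++ B) (unroll v) alpha l (K + k)
        = B`_l + alpha * `|u - (w - 2 * pi)|,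
      cone (B ++ B ++ B) (unroll v) alpha (K + l) (K + k)
        = B`_l + alpha * `|u - w| &
      cone (B ++ B ++ B) (unroll v) alpha (K + (K + l)) (K + k)
        = B`_l + alpha * `|u - (w + 2 * pi)|].
Proof.
move=> sz ltk ltl K u w.
have addKI n : (K + n < K)%N = false by apply/negbTE; rewrite -leqNgt leq_addr.
by split; rewrite /cone /unroll !nth_cat !size_map sz -/K !addKI ?addKn ?addKI
  ?addKn ?ltk ?ltl // (nth_map 0) // sz.
Qed.

Lemma distTransCircP {R : realType} (B v : seq R) (alpha : R) :
  0 <= alpha -> sorted <=%R v -> {in v, forall x, - pi < x <= pi} ->
  size v = size B ->
  let D := outcome (distTransCirc B v alpha) in
  (forall k l, (k < size B)%N -> (l < size B)%N ->
     D`_k <= B`_l + alpha * arc_dist v`_k v`_l) /\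
  (forall k, (k < size B)%N ->
     exists2 l, (l < size B)%N & B`_l + alpha * arc_dist v`_k v`_l <= D`_k).
Proof.
move=> a0 sv v_pi sz.
rewrite outcome_distTransCirc.
have nth_pi i : (i < size B)%N -> - pi < v`_i <= pi.
  by move=> lti; apply/v_pi/mem_nth; rewrite sz.
have sz3 : size (B ++ B ++ B) = (size B + (size B + size B))%N by rewrite !size_cat.
have [|supD ubD] :=
  distTransRealP (B ++ B ++ B) (unroll v) alpha a0 (sorted_unroll v sv v_pi).
  by rewrite size_unroll sz3 sz; lia.
move: (outcome _) supD ubD => D supD ubD.
split.
- move=> k l ltk ltl; rewrite nth_take // nth_drop arc_distE ?nth_pi //.
  have [c1 c2 c3] := cone_unroll B v alpha k l sz ltk ltl.
  rewrite [Num.min `|_ - (_ - _)| _]minElt minElt.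
  by do 2?case: ifP => _; rewrite -?c1 -?c2 -?c3; apply: ubD; rewrite sz3; lia.
- move=> k ltk; rewrite nth_take // nth_drop.
  have ltKk : (size B + k < size (B ++ B ++ B))%N by rewrite sz3; lia.
  have [l ltl] := supD _ ltKk.
  rewrite sz3 in ltl.
  have [i lti copies] : exists2 i, (i < size B)%N &
      l \in [:: i; size B + i; size B + (size B + i)]%N.
    have [lt1|le1] := ltnP l (size B); first by exists l; rewrite // inE eqxx.
    have [lt2|le2] := ltnP l (size B + size B).
      by exists (l - size B)%N; [lia | rewrite !inE; lia].
    by exists (l - size B - size B)%N; [lia | rewrite !inE; lia].
  have [c1 c2 c3] := cone_unroll B v alpha k i sz ltk lti.
  move=> supl; exists i => //; apply: le_trans supl.
  rewrite arc_distE ?nth_pi //; move: copies; rewrite !inE.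
  by case/or3P=> /eqP->; rewrite ?c1 ?c2 ?c3 lerD2l ler_wpM2l // !ge_min lexx ?orbT.
Qed.

Lemma cost_distTransCirc {R : realType} (B v : seq R) (alpha : R) :
  size v = size B -> (0 < size B)%N ->
  cost (distTransCirc B v alpha) = (42 * size B - 9)%N.
Proof.
move=> sz B0; have := size_distTransCirc B v alpha.
rewrite /distTransCirc /= !outcome_copy => szD.
rewrite !(cost_mapc 0 (@retc R)) // !(cost_mapc 1) // szD.
rewrite !(cost_forc 5) // size_rev !size_iota !size_cat sz.
lia.
Qed.

Theorem theorem4 (R : realType) :
  exists C : nat,
    forall (K : nat) (B v : K.-tuple R) (alpha : R),
      (1 <= K)%N ->
      (forall k : 'I_K, - pi < v`_k <= pi) ->
      sorted <%R v ->
      0 < alpha ->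
      let run := distTransCirc B v alpha in
      [/\ size (outcome run) = K,
          forall k : 'I_K,
            (outcome run)`_k =
            \big[Num.min/B`_k + alpha * arc_dist v`_k v`_k]_(l < K)
              (B`_l + alpha * arc_dist v`_k v`_l)
        & (cost run <= C * K)%N].
Proof.
exists 42%N => K B v alpha K0 v_pi sv a0 run.
have szv : size v = size B by rewrite !size_tuple.
have v_in_pi : {in v, forall x, - pi < x <= pi}.
  by move=> _ /tnthP[k ->]; rewrite (tnth_nth 0).
have [ubD supD] :=
  distTransCircP B v alpha (ltW a0) (sub_sorted (@ltW _ _) sv) v_in_pi szv.
have szD := size_distTransCirc B v alpha.
have cost_run := cost_distTransCirc B v alpha szv.
rewrite -/run in szD ubD supD cost_run; rewrite size_tuple in szD ubD supD cost_run.
split=> // [k|]; last by rewrite cost_run // leq_subr.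
apply/le_anti/andP; split.
  by apply: le_bigmin => [|l _]; apply: ubD.
have [l ltl suppl] := supD k (ltn_ord k).
exact: (bigmin_inf (Ordinal ltl)).
Qed.
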